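(* Let $\mathfrak{m}$ and $\mathfrak{h}$ be vector spaces over a field $k$, equipped with linear maps $$\phi:\mathfrak m\otimes\mathfrak m\to\mathfrak m,\quad \theta:\mathfrak m\otimes\mathfrak m\to\mathfrak h,\quad \mu:\mathfrak h\otimes\mathfrak h\to\mathfrak h,\quad \gamma:\mathfrak h\otimes\mathfrak h\to\mathfrak m,\quad \varphi:\mathfrak h\otimes\mathfrak m\to\mathfrak m,\quad \psi:\mathfrak h\otimes\mathfrak m\to\mathfrak h .$$ Then the direct sum $\mathfrak g:=\mathfrak m\oplus\mathfrak h$ is a Lie algebra via $$[\xi+Z,\xi'+Z']=\Big(\phi(\xi,\xi')+\varphi(Z,\xi')-\varphi(Z',\xi)+\gamma(Z,Z')\Big)+\Big(\mu(Z,Z')+\psi(Z,\xi')-\psi(Z',\xi)+\theta(\xi,\xi')\Big)$$ if and only if the following hold for all $\xi,\xi',\xi''\in\mathfrak m$ and $Z,Z',Z''\in\mathfrak h$: 1. $\phi(\xi,\xi)=0$, $\theta(\xi,\xi)=0$, $\gamma(Z,Z)=0$, $\mu(Z,Z)=0$; 2. $\varphi(Z,\phi(\xi,\xi'))=\phi(\varphi(Z,\xi),\xi')+\phi(\xi,\varphi(Z,\xi'))+\varphi(\psi(Z,\xi),\xi')-\varphi(\psi(Z,\xi'),\xi)+\gamma(\theta(\xi,\xi'),Z)$; 3. $\mu(Z,\theta(\xi,\xi'))=\theta(\varphi(Z,\xi),\xi')+\theta(\xi,\varphi(Z,\xi'))+\psi(\psi(Z,\xi),\xi')-\psi(\psi(Z,\xi'),\xi)-\psi(Z,\phi(\xi,\xi'))$;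 4. $\varphi(\mu(Z,Z'),\xi)=\varphi(Z,\varphi(Z',\xi))-\varphi(Z',\varphi(Z,\xi))+\gamma(\psi(Z,\xi),Z')+\gamma(Z,\psi(Z',\xi))-\phi(\gamma(Z,Z'),\xi)$; 5. $\psi(\mu(Z,Z'),\xi)=\mu(Z,\psi(Z',\xi))+\mu(\psi(Z,\xi),Z')+\psi(Z,\varphi(Z',\xi))-\psi(Z',\varphi(Z,\xi))-\theta(\gamma(Z,Z'),\xi)$; 6. $\sum_{(\xi,\xi',\xi'')}\phi(\phi(\xi,\xi'),\xi'')+\sum_{(\xi,\xi',\xi'')}\varphi(\theta(\xi,\xi'),\xi'')=0$; 7. $\sum_{(\xi,\xi',\xi'')}\psi(\theta(\xi,\xi'),\xi'')+\sum_{(\xi,\xi',\xi'')}\theta(\phi(\xi,\xi'),\xi'')=0$; 8. $\sum_{(Z,Z',Z'')}\gamma(\mu(Z,Z'),Z'')-\sum_{(Z,Z',Z'')}\varphi(Z,\gamma(Z',Z''))=0$; 9. $\sum_{(Z,Z',Z'')}\mu(\mu(Z,Z'),Z'')-\sum_{(Z,Z',Z'')}\psi(Z,\gamma(Z',Z''))=0$; where each sum is over the cyclic permutations of the indicated elements.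
   Context: For a linear map such as $\phi:\mathfrak m\otimes\mathfrak m\to\mathfrak m$ one writes $\phi(\xi,\xi'):=\phi(\xi\otimes\xi')$, and similarly for the other maps. Elements of $\mathfrak m$ are denoted $\xi,\xi',\xi''$ and elements of $\mathfrak h$ are denoted $Z,Z',Z''$. A Lie bracket is a bilinear map satisfying $[X,X]=0$ and the Jacobi identity. *)

(* Defs.v *)
From mathcomp Require Import all_boot all_order all_algebra.

Set Implicit Arguments.
Unset Strict Implicit.
Unset Printing Implicit Defensive.

Import GRing.Theory.
Local Open Scope ring_scope.

Definition cycsum (T : Type) (V : nmodType) (F : T -> T -> T -> V)
    (x y z : T) : V :=
  F x y z + F y z x + F z x y.

Definition is_lie_bracket (k : fieldType) (g : lmodType k)
    (br : g -> g -> g) : Prop :=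
  [/\ forall Y, linear (fun X => br X Y),
      forall X, linear (br X),
      forall X, br X X = 0
    & forall X Y Z, cycsum (fun A B C => br (br A B) C) X Y Z = 0].

(* The element xi + Z of the direct sum is the pair (xi, Z). The product type
   carries the componentwise lmodType structure.
   Bilinear maps stand for linear maps out of the tensor products. *)
Definition sum_bracket (k : fieldType) (m h : lmodType k)
    (phi : {bilinear m -> m -> m}) (theta : {bilinear m -> m -> h})
    (mu : {bilinear h -> h -> h}) (gamma : {bilinear h -> h -> m})
    (varphi : {bilinear h -> m -> m}) (psi : {bilinear h -> m -> h})
    (X Y : m * h) : m * h :=
  let: (xi, Z) := X in
  let: (xi', Z') := Y in
  (phi xi xi' + varphi Z xi' - varphi Z' xi + gamma Z Z',
   mu Z Z' + psi Z xi' - psi Z' xi + theta xi xi').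

(* Main.v *)
(* The bracket is bilinear by construction, and it is alternating exactly when
   condition 1 holds. The Jacobiator of a biadditive bracket is triadditive and
   invariant under cyclic rotation, so it vanishes as soon as it does on the
   triples of types (m,m,m), (h,m,m), (h,h,m) and (h,h,h); there its two
   components are the defects of conditions 6-7, 2-3, 4-5 and 8-9. *)

Require Import Defs.
From mathcomp Require Import all_boot all_order all_algebra.

Set Implicit Arguments.
Unset Strict Implicit.
Unset Printing Implicit Defensive.

Import GRing.Theory.
Local Open Scope ring_scope.

(** Regroups the four summands of a bracket component once linearity has split each of them in
    two. *)
Lemma addr4ACA (V : zmodType) (a b c d a' b' c' d' : V) :
  (a + a') + (b + b') + (c + c') + (d + d')
  = (a + b + c + d) + (a' + b' + c' + d').
Proof. by rewrite (addrACA a) (addrACA (a + b)) (addrACA (a + b + c)). Qed.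

Section Jacobiator.
Variables (g : zmodType) (br : g -> g -> g).
Hypotheses (brDl : forall X Y Z, br (X + Y) Z = br X Z + br Y Z)
           (brDr : forall X Y Z, br X (Y + Z) = br X Y + br X Z).

Definition jacobiator := cycsum (fun A B C => br (br A B) C).

Lemma jacobiator_rot X Y Z : jacobiator X Y Z = jacobiator Y Z X.
Proof. by rewrite /jacobiator /cycsum -addrA addrC. Qed.

(** Each nested bracket is additive in every slot. Combined with [jacobiator_rot], additivity in the
    first argument serves for all three. *)
Lemma jacobiatorDl X X' Y Z :
  jacobiator (X + X') Y Z = jacobiator X Y Z + jacobiator X' Y Z.
Proof.
rewrite /jacobiator /cycsum !(brDl, brDr).
by rewrite (addrACA (br (br X Y) Z)) (addrACA (_ + _)).
Qed.

End Jacobiator.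

Lemma altN (k : fieldType) (U V : lmodType k) (b : {bilinear U -> U -> V}) :
  (forall u, b u u = 0) -> forall u v, b v u = - b u v.
Proof.
move=> b0 u v; apply/eqP; rewrite -addr_eq0 addrC; apply/eqP.
by have := b0 (u + v); rewrite linearDl !linearDr !b0 add0r addr0.
Qed.

Section SumBracket.
Variables (k : fieldType) (m h : lmodType k).
Variables (phi : {bilinear m -> m -> m}) (theta : {bilinear m -> m -> h}).
Variables (mu : {bilinear h -> h -> h}) (gamma : {bilinear h -> h -> m}).
Variables (varphi : {bilinear h -> m -> m}) (psi : {bilinear h -> m -> h}).

Local Notation br := (sum_bracket phi theta mu gamma varphi psi).
Local Notation jac := (jacobiator br).

Lemma sum_bracket_linearl Y : linear (fun X => br X Y).
Proof.
case: Y => y w a [x z] [x' z'].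
(* The sign of the third summand is pushed inside its linear combination, so that all four summands
   have the same shape. *)
by congr (_, _); rewrite !linearPl !linearPr /= opprD -scalerN addr4ACA
  -!scalerDr.
Qed.

Lemma sum_bracket_linearr X : linear (br X).
Proof.
case: X => y w a [x z] [x' z'].
by congr (_, _); rewrite !linearPl !linearPr /= opprD -scalerN addr4ACA
  -!scalerDr.
Qed.

Lemma sum_bracketDl X Y Z : br (X + Y) Z = br X Z + br Y Z.
Proof. by have /= := sum_bracket_linearl Z 1 X Y; rewrite !scale1r. Qed.

Lemma sum_bracketDr X Y Z : br X (Y + Z) = br X Y + br X Z.
Proof. by have := sum_bracket_linearr X 1 Y Z; rewrite !scale1r. Qed.

Lemma jac_split0 x z Y Z :
  jac (x, 0) Y Z = 0 -> jac (0, z) Y Z = 0 -> jac (x, z) Y Z = 0.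
Proof.
move=> jx jz; have -> : (x, z) = (x, 0) + (0, z).
  by congr (_, _); rewrite ?addr0 ?add0r.
by rewrite (jacobiatorDl sum_bracketDl sum_bracketDr) jx jz addr0.
Qed.

(** Arguments lying in a single summand have a zero component; these rules erase every term that
    contains it. *)
Let simp0 := (linear0l, linear0r, addr0, add0r, subr0, sub0r, oppr0).

Lemma jac_mmm x y z :
  jac (x, 0) (y, 0) (z, 0) =
  (cycsum (fun a b c => phi (phi a b) c) x y z
     + cycsum (fun a b c => varphi (theta a b) c) x y z,
   cycsum (fun a b c => psi (theta a b) c) x y z
     + cycsum (fun a b c => theta (phi a b) c) x y z).
Proof.
rewrite /jacobiator /cycsum /sum_bracket /= !simp0.
congr (_, _) => /=; rewrite ?opprD ?opprK.
  (* Each rotation contributes a pair of terms; first members are collected before second ones. *)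
  by rewrite [LHS](AC (2*2*2) (1*3*5*(2*4*6))).
by rewrite [LHS](AC (2*2*2) (1*3*5*(2*4*6))).
Qed.

Lemma jac_hhh x y z :
  jac (0, x) (0, y) (0, z) =
  (cycsum (fun a b c => gamma (mu a b) c) x y z
     - cycsum (fun a b c => varphi a (gamma b c)) x y z,
   cycsum (fun a b c => mu (mu a b) c) x y z
     - cycsum (fun a b c => psi a (gamma b c)) x y z).
Proof.
rewrite /jacobiator /cycsum /sum_bracket /= !simp0.
congr (_, _) => /=; rewrite ?opprD ?opprK.
  (* The double bracket yields [varphi c (gamma a b)] instead of [varphi a (gamma b c)]: the same
     cyclic sum, started one term later, hence the order 3, 5, 1. *)
  by rewrite [LHS](AC (2*2*2) (2*4*6*(3*5*1))).
by rewrite [LHS](AC (2*2*2) (1*3*5*(4*6*2))).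
Qed.

Hypotheses (phi0 : forall x, phi x x = 0) (theta0 : forall x, theta x x = 0).
Hypotheses (gamma0 : forall z, gamma z z = 0) (mu0 : forall z, mu z z = 0).

Lemma jac_hmm z x y :
  jac (0, z) (x, 0) (y, 0) =
  (phi (varphi z x) y + phi x (varphi z y) + varphi (psi z x) y
     - varphi (psi z y) x + gamma (theta x y) z - varphi z (phi x y),
   theta (varphi z x) y + theta x (varphi z y) + psi (psi z x) y
     - psi (psi z y) x - psi z (phi x y) - mu z (theta x y)).
Proof.
rewrite /jacobiator /cycsum /sum_bracket /= !(simp0, linearNl, linearNr).
(* Antisymmetry moves [x], respectively [z], from the second slot to the first, where conditions 2
   and 3 have it; naming that element restricts the rewrite to the right term. *)
rewrite (altN phi0 x) (altN theta0 x) (altN mu0 z).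
congr (_, _) => /=; rewrite ?opprD ?opprK.
  by rewrite [LHS](AC (2*2*2) (1*5*2*6*4*3)).
by rewrite [LHS](AC (2*2*2) (2*6*1*5*4*3)).
Qed.

Lemma jac_hhm z w x :
  jac (0, z) (0, w) (x, 0) =
  (varphi (mu z w) x - (varphi z (varphi w x) - varphi w (varphi z x)
     + gamma (psi z x) w + gamma z (psi w x) - phi (gamma z w) x),
   psi (mu z w) x - (mu z (psi w x) + mu (psi z x) w
     + psi z (varphi w x) - psi w (varphi z x) - theta (gamma z w) x)).
Proof.
rewrite /jacobiator /cycsum /sum_bracket /= !(simp0, linearNl, linearNr).
rewrite (altN gamma0 z) (altN mu0 z).
congr (_, _) => /=; rewrite ?opprD ?opprK.
  by rewrite [LHS](AC (2*2*2) (2*(3*5*6*4*1))).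
by rewrite [LHS](AC (2*2*2) (1*(3*5*4*6*2))).
Qed.
End SumBracket.

Theorem proposition2p1 (k : fieldType) (m h : lmodType k)
    (phi : {bilinear m -> m -> m}) (theta : {bilinear m -> m -> h})
    (mu : {bilinear h -> h -> h}) (gamma : {bilinear h -> h -> m})
    (varphi : {bilinear h -> m -> m}) (psi : {bilinear h -> m -> h}) :
  is_lie_bracket (sum_bracket phi theta mu gamma varphi psi) <->
  ((forall (xi : m) (Z : h),
      [/\ phi xi xi = 0, theta xi xi = 0, gamma Z Z = 0 & mu Z Z = 0]) /\
   (forall (xi xi' : m) (Z : h),
      varphi Z (phi xi xi') =
        phi (varphi Z xi) xi' + phi xi (varphi Z xi')
        + varphi (psi Z xi) xi' - varphi (psi Z xi') xi
        + gamma (theta xi xi') Z) /\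
   (forall (xi xi' : m) (Z : h),
      mu Z (theta xi xi') =
        theta (varphi Z xi) xi' + theta xi (varphi Z xi')
        + psi (psi Z xi) xi' - psi (psi Z xi') xi
        - psi Z (phi xi xi')) /\
   (forall (xi : m) (Z Z' : h),
      varphi (mu Z Z') xi =
        varphi Z (varphi Z' xi) - varphi Z' (varphi Z xi)
        + gamma (psi Z xi) Z' + gamma Z (psi Z' xi)
        - phi (gamma Z Z') xi) /\
   (forall (xi : m) (Z Z' : h),
      psi (mu Z Z') xi =
        mu Z (psi Z' xi) + mu (psi Z xi) Z'
        + psi Z (varphi Z' xi) - psi Z' (varphi Z xi)
        - theta (gamma Z Z') xi) /\
   (forall xi xi' xi'' : m,
      cycsum (fun a b c => phi (phi a b) c) xi xi' xi''
      + cycsum (fun a b c => varphi (theta a b) c) xi xi' xi'' = 0) /\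
   (forall xi xi' xi'' : m,
      cycsum (fun a b c => psi (theta a b) c) xi xi' xi''
      + cycsum (fun a b c => theta (phi a b) c) xi xi' xi'' = 0) /\
   (forall Z Z' Z'' : h,
      cycsum (fun a b c => gamma (mu a b) c) Z Z' Z''
      - cycsum (fun a b c => varphi a (gamma b c)) Z Z' Z'' = 0) /\
   (forall Z Z' Z'' : h,
      cycsum (fun a b c => mu (mu a b) c) Z Z' Z''
      - cycsum (fun a b c => psi a (gamma b c)) Z Z' Z'' = 0)).
Proof.
set br := sum_bracket _ _ _ _ _ _.
split=> [[_ _ br0 J] | [c1 [c2 [c3 [c4 [c5 [c6 [c7 [c8 c9]]]]]]]]].
  have alt x z : [/\ phi x x = 0, theta x x = 0, gamma z z = 0 & mu z z = 0].
    have [+ +] := br0 (x, 0); have [+ +] := br0 (0, z).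
    by rewrite !(linear0l, linear0r, addr0, add0r, subr0, oppr0).
  (* [alt] quantifies over both spaces at once; [0] fills the irrelevant slot. *)
  have phi0 x : phi x x = 0 by have [] := alt x 0.
  have theta0 x : theta x x = 0 by have [] := alt x 0.
  have gamma0 z : gamma z z = 0 by have [] := alt 0 z.
  have mu0 z : mu z z = 0 by have [] := alt 0 z.
  (* [J] is the vanishing of [jacobiator] up to unfolding, so it chains with the computed value to
     give a pair equal to zero, read off componentwise below. *)
  have J_hmm z x y :=
    etrans (esym (jac_hmm gamma varphi psi phi0 theta0 mu0 z x y)) (J _ _ _).
  have J_hhm z w x :=
    etrans (esym (jac_hhm phi theta varphi psi gamma0 mu0 z w x)) (J _ _ _).
  have J_mmm x y z :=
    etrans (esym (jac_mmm phi theta mu gamma varphi psi x y z)) (J _ _ _).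
  have J_hhh x y z :=
    etrans (esym (jac_hhh phi theta mu gamma varphi psi x y z)) (J _ _ _).
  do ![split] => //.
  - by move=> x y z; have [/subr0_eq <-] := J_hmm z x y.
  - by move=> x y z; have [_ /subr0_eq <-] := J_hmm z x y.
  - by move=> x z w; have [/subr0_eq <-] := J_hhm z w x.
  - by move=> x z w; have [_ /subr0_eq <-] := J_hhm z w x.
  - by move=> x y z; have [-> _] := J_mmm x y z.
  - by move=> x y z; have [_ ->] := J_mmm x y z.
  - by move=> x y z; have [-> _] := J_hhh x y z.
  - by move=> x y z; have [_ ->] := J_hhh x y z.
have phi0 x : phi x x = 0 by have [] := c1 x 0.
have theta0 x : theta x x = 0 by have [] := c1 x 0.
have gamma0 z : gamma z z = 0 by have [] := c1 0 z.
have mu0 z : mu z z = 0 by have [] := c1 0 z.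
have J_mmm x y z : jacobiator br (x, 0) (y, 0) (z, 0) = 0.
  by rewrite jac_mmm c6 c7.
have J_hhh x y z : jacobiator br (0, x) (0, y) (0, z) = 0.
  by rewrite jac_hhh c8 c9.
have J_hmm z x y : jacobiator br (0, z) (x, 0) (y, 0) = 0.
  by rewrite jac_hmm // c2 c3 !subrr.
have J_hhm z w x : jacobiator br (0, z) (0, w) (x, 0) = 0.
  by rewrite jac_hhm // c4 c5 !subrr.
split.
- exact: sum_bracket_linearl.
- exact: sum_bracket_linearr.
- case=> x z; rewrite /br /= phi0 theta0 gamma0 mu0.
  (* For equal arguments the [varphi] terms cancel each other, and so do the [psi] terms. *)
  by rewrite !(add0r, addr0, subrr).
- move=> [x x'] [y y'] [z z']; change (jacobiator br (x, x') (y, y') (z, z') = 0).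
  (* Rotating between splits brings each argument to the front in turn. Each of the eight resulting
     triples is, after at most two further rotations, of one of the four types settled above. *)
  by apply: jac_split0; rewrite jacobiator_rot; apply: jac_split0;
    rewrite jacobiator_rot; apply: jac_split0;
    rewrite ?(J_mmm, J_hmm, J_hhm, J_hhh) // jacobiator_rot
            ?(J_hmm, J_hhm) // jacobiator_rot ?(J_hmm, J_hhm).
Qed.
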